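(* Let $\beta_1,\beta_2$ be non-constant complex rational functions, and let $K_1,K_2$ be subsets of $\mathbb{R}$ such that the intersection $\beta_1^{-1}(K_1)\cap\beta_2^{-1}(K_2)$ is infinite. Then there exist a rational function $W$ and rational functions $P_1,P_2$ with real coefficients such that $\beta_1=P_1\circ W$ and $\beta_2=P_2\circ W$.
   Context: Preimages are taken in the Riemann sphere $\mathbb{CP}^1$. *)

(* Defs.v *)
From HB Require Import structures.
From mathcomp Require Import all_boot all_order all_algebra.
From mathcomp Require Import complex.
From mathcomp Require Import classical_sets cardinality reals.
Set Implicit Arguments. Unset Strict Implicit. Unset Printing Implicit Defensive.
Import Order.TTheory GRing.Theory Num.Theory.
Local Open Scope ring_scope.

Section RatFun.
Variable R : realType.
Local Notation C := R[i].

Record ratf := Ratf {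
  ratf_num : {poly C};
  ratf_den : {poly C};
  ratf_den_neq0 : ratf_den != 0;
  ratf_coprime : coprimep ratf_num ratf_den }.

Definition ratf_eq (f g : ratf) : Prop :=
  ratf_num f * ratf_den g = ratf_num g * ratf_den f.

Definition ratf_const (f : ratf) : Prop :=
  exists c : C, ratf_num f = c *: ratf_den f.

Definition ratf_real (f : ratf) : Prop :=
  (ratf_num f \is a polyOver Num.real) /\ (ratf_den f \is a polyOver Num.real).

(* Composition P o W, as a pair (numerator, denominator):
   P(c/d) = (sum_i a_i c^i d^(n-i)) / (sum_i b_i c^i d^(n-i)),
   with n = deg P = max(deg a, deg b). *)
Definition ratf_deg (f : ratf) : nat :=
  (maxn (size (ratf_num f)) (size (ratf_den f))).-1.

Definition homog_comp (n : nat) (a c d : {poly C}) : {poly C} :=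
  \sum_(i < size a) a`_i *: (c ^+ i * d ^+ (n - i)).

Definition comp_num (P W : ratf) : {poly C} :=
  homog_comp (ratf_deg P) (ratf_num P) (ratf_num W) (ratf_den W).
Definition comp_den (P W : ratf) : {poly C} :=
  homog_comp (ratf_deg P) (ratf_den P) (ratf_num W) (ratf_den W).

Definition ratf_eq_comp (f P W : ratf) : Prop :=
  comp_den P W != 0 /\
  ratf_num f * comp_den P W = comp_num P W * ratf_den f.

(* The Riemann sphere CP^1 = C u {oo}, with None = oo. *)
Definition CP1 := option C.

Definition ratf_eval (f : ratf) (z : CP1) : CP1 :=
  match z with
  | Some x => if (ratf_den f).[x] == 0 then None
              else Some ((ratf_num f).[x] / (ratf_den f).[x])
  | None => if (size (ratf_num f) > size (ratf_den f))%N then None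
            else if size (ratf_num f) == size (ratf_den f)
                 then Some (lead_coef (ratf_num f) / lead_coef (ratf_den f))
                 else Some 0
  end.

Definition ratf_preimage (f : ratf) (K : set R) : set CP1 :=
  [set z | exists2 r : R, K r & ratf_eval f z = Some (r%:C)%C].

End RatFun.

(* Main.v *)
(** Let X be the infinite set of points where both functions are real.  The
    rational functions f for which there is a rational f* with f* = conj f on X
    form a subfield of C(z) that contains C and both beta_i.  By Lüroth's
    theorem it is C(v); in particular v* = S(v) with S rational, so the infinite
    set T = v(X) satisfies conj t = S(t).  Applying this twice shows that S is a
    Möbius map, so T lies on a circle, and a Möbius change of the generator v
    gives a generator W that is real on X.  A reduced fraction P with
    beta_i = P(W) takes real values at infinitely many real points, hence has
    real coefficients once its denominator is monic. *)
Require Import Defs.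
From HB Require Import structures.
From mathcomp Require Import all_boot all_order all_algebra.
From mathcomp Require Import complex polyXY generic_quotient.
From mathcomp Require Import boolp classical_sets cardinality reals.
Set Implicit Arguments. Unset Strict Implicit. Unset Printing Implicit Defensive.
Import Order.TTheory GRing.Theory Num.Theory.
Local Open Scope ring_scope.

(** * Subfields and Gauss's lemma *)

(** Membership is a proposition because the subfields in use are defined by the existence of
    suitable fractions. *)
Record subfield_pred (K : fieldType) (E : K -> Prop) : Prop := SubfieldPred {
  subfield1 : E 1;
  subfieldB : forall x y, E x -> E y -> E (x - y);
  subfieldM : forall x y, E x -> E y -> E (x * y);
  subfieldV : forall x, E x -> E x^-1 }.

Section SubfieldTheory.
Variables (K : fieldType) (E : K -> Prop) (sE : subfield_pred E).

Lemma subfield0 : E 0.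
Proof. by rewrite -(subrr 1); apply: subfieldB (subfield1 sE) (subfield1 sE). Qed.

Lemma subfieldN x : E x -> E (- x).
Proof. by move=> Ex; rewrite -sub0r; apply: subfieldB subfield0 Ex. Qed.

Lemma subfieldD x y : E x -> E y -> E (x + y).
Proof.
by move=> Ex Ey; rewrite -[y]opprK; apply: subfieldB => //; apply: subfieldN.
Qed.

Lemma subfield_div x y : E x -> E y -> E (x / y).
Proof. by move=> Ex Ey; apply: subfieldM => //; apply: subfieldV. Qed.

(** Horner's scheme: the remainder of [P * 'X + c] arises from that of [P] by field operations on
    coefficients, hence stays over [E]. *)
Lemma subfield_edivp (M P : {poly K}) : M != 0 ->
  (forall i, E M`_i) -> (forall i, E P`_i) ->
  exists Q, (size (P - Q * M)%R < size M)%N /\ forall i, E (P - Q * M)`_i.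
Proof.
move=> M0 EM; elim/poly_ind: P => [|P c IH] EP.
  by exists 0; rewrite mul0r subr0 size_poly0 size_poly_gt0; split.
have EP' i : E P`_i by move: (EP i.+1); rewrite coefD coefMX coefC /= addr0.
have Ec : E c by move: (EP 0); rewrite coefD coefMX coefC /= add0r.
have [Q [sQ EQ]] := IH EP'.
set r := P - Q * M in sQ EQ.
set r1 := r * 'X + c%:P.
have Er1 i : E r1`_i.
  by rewrite coefD coefMX coefC; case: i => [|i] /=; rewrite ?add0r ?addr0.
(* [r1] has size at most [size M]; [a] serves to cancel its coefficient of degree [(size M).-1]. *)
set a := r1`_(size M).-1 / lead_coef M.
exists (Q * 'X + a%:P).
have -> : P * 'X + c%:P - (Q * 'X + a%:P) * M = r1 - a *: M.
  rewrite /r1 /r mulrDl mulrBl mul_polyC opprD addrA; congr (_ - _).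
  by rewrite -!mulrA (mulrC 'X M) addrAC.
split; last first.
  move=> i; rewrite coefB coefZ; apply: subfieldB => //; apply: subfieldM => //.
  by apply: subfield_div; rewrite ?/lead_coef.
rewrite -[X in (_ < X)%N]prednK ?size_poly_gt0 // ltnS.
apply/leq_sizeP => j; rewrite leq_eqVlt => /orP[/eqP<-|ltj].
  rewrite coefB coefZ /a -/(lead_coef M) mulfVK ?subrr //.
  by rewrite lead_coef_eq0.
rewrite coefB coefZ.
have sMj : (size M <= j)%N by case: (size M) ltj.
rewrite [M`_j]nth_default // mulr0 subr0 nth_default //.
apply: leq_trans (size_polyD _ _) _; rewrite geq_max; apply/andP; split.
  by apply: leq_trans (size_polyMleq _ _) _; rewrite size_polyX addn2 /=; apply: leq_trans sMj.
by apply: leq_trans (size_polyC_leq1 _) _; apply: leq_trans sMj; rewrite size_poly_gt0.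
Qed.

End SubfieldTheory.

Section Gauss.
Variable k : closedFieldType.

(** Over an algebraically closed field, coefficients without a common root have constant content. *)
Definition primitiveX (G : {poly {poly k}}) := forall x, exists j, ~~ root G`_j x.

Lemma map_eval_eq0 (G : {poly {poly k}}) x :
  (map_poly (horner_eval x) G == 0) <-> (forall j, root G`_j x).
Proof.
split=> [/eqP G0 j|G0].
  by have := congr1 (fun p : {poly k} => p`_j) G0; rewrite coef_map coef0 => /eqP.
by apply/eqP/polyP => j; rewrite coef_map coef0; apply/eqP/G0.
Qed.

Lemma dvd_coefs (G : {poly {poly k}}) x : (forall j, root G`_j x) ->
  exists G', G = ('X - x%:P)%:P * G'.
Proof.
move=> G0; exists (map_poly (fun p => p %/ ('X - x%:P)) G).
apply/polyP => j; rewrite coefCM coef_map_id0 ?div0p // mulrC divpK //.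
by rewrite dvdp_XsubCl.
Qed.

(** The linear factors of [h] are cancelled one at a time: at a root [x] of [h] the specialisation
    of [G * H] vanishes but that of [G] does not, so ['X - x%:P] divides all coefficients of [H]. *)
Lemma gauss (F G H : {poly {poly k}}) (h : {poly k}) : primitiveX G -> h != 0 ->
  h%:P * F = G * H -> exists H', F = G * H'.
Proof.
move=> pG; have [n] := ubnP (size h); elim: n => // n IH in h H *.
rewrite ltnS => sh h0 hF.
have [/eqP s1|s1] := boolP (size h == 1).
  have /size_poly1P[c c0 hc] : size h == 1 by rewrite s1.
  exists ((c^-1)%:P%:P * H).
  rewrite mulrCA -hF hc mulrA -!polyCM mulVf // mul1r //.
have [x hx] := closed_rootP h s1.
have H0 j : root H`_j x.
  move: j; apply/map_eval_eq0.
  have := congr1 (map_poly (horner_eval x)) hF.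
  rewrite !rmorphM /= map_polyC /= /horner_eval (eqP hx) mul0r => /esym/eqP.
  rewrite mulf_eq0 => /orP[|//] /map_eval_eq0 G0.
  by have [j] := pG x; rewrite G0.
have [H' HH'] := dvd_coefs H0.
have /factor_theorem[h' hh'] := hx.
have h'0 : h' != 0 by apply: contraNneq h0 => h'0; rewrite hh' h'0 mul0r.
apply: (IH h' H') => //.
  by move: sh; rewrite hh' size_Mmonic ?monicXsubC // size_XsubC addn2.
have X0 : ('X - x%:P)%:P != 0 :> {poly {poly k}} by rewrite polyC_eq0 polyXsubC_eq0.
apply: (mulfI X0); rewrite [RHS]mulrCA -HH' -hF hh' polyCM mulrA; congr (_ * _).
by rewrite mulrC.
Qed.

(** Common linear factors of the coefficients are pulled out one by one; each lowers the degree of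
    the leading coefficient. *)
Lemma primitive_part (G : {poly {poly k}}) : G != 0 ->
  exists c G', [/\ c != 0, primitiveX G' & G = c%:P * G'].
Proof.
have [n] := ubnP (size (lead_coef G)); elim: n => // n IH in G *.
rewrite ltnS => sG G0.
have [pG|] := pselect (primitiveX G).
  by exists 1, G; rewrite oner_eq0 mul1r; split.
move=> /existsNP[x /forallNP npG].
have [j|G' GG'] := @dvd_coefs G x; first exact: contra_notT (npG j).
have X0 : 'X - x%:P != 0 by rewrite polyXsubC_eq0.
have G'0 : G' != 0 by apply: contraNneq G0 => G'0; rewrite GG' G'0 mulr0.
have [|//|c [G2 [c0 pG2 E]]] := IH G'.
  move: sG; rewrite GG' lead_coefM lead_coefC mulrC.
  by rewrite size_Mmonic ?monicXsubC ?lead_coef_eq0 // size_XsubC addn2.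
exists (('X - x%:P) * c), G2; split=> //; first by rewrite mulf_neq0.
by rewrite GG' E polyCM mulrA.
Qed.

End Gauss.

(** * Rational functions and the field generated by one of them *)

Section Fractions.
Variable k : fieldType.
Local Notation K := {fraction {poly k}}.
Local Notation "x %:F" := (@FracField.tofrac {poly k} x).

Lemma fracP (f : K) : exists a b, b != 0 /\ f = a%:F / b%:F.
Proof.
elim/quotW: f => r; exists (\n_r), (\d_r); split; first exact: denom_ratioP.
apply: (mulIf (_ : (\d_r)%:F != 0)); first by rewrite tofrac_eq0 denom_ratioP.
rewrite mulfVK ?tofrac_eq0 ?denom_ratioP //.
apply/eqP; rewrite !piE /FracField.mulf /FracField.equivf /=.
by rewrite !numden_Ratio ?mulf_neq0 ?oner_neq0 ?denom_ratioP // !mulr1 mulrC.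
Qed.

Lemma frac_coprime (a b : {poly k}) : b != 0 -> exists a' b',
  [/\ b' != 0, coprimep a' b', a%:F / b%:F = a'%:F / b'%:F,
      (size a' <= size a)%N & (size b' <= size b)%N].
Proof.
move=> b0; pose g := gcdp a b.
have g0 : g != 0 by rewrite gcdp_eq0 negb_and b0 orbT.
have Ea : a = a %/ g * g by rewrite divpK // dvdp_gcdl.
have Eb : b = b %/ g * g by rewrite divpK // dvdp_gcdr.
have b'0 : b %/ g != 0 by apply: contraNneq b0 => b'0; rewrite Eb b'0 mul0r.
exists (a %/ g), (b %/ g); split=> //; rewrite ?leq_divp //.
  by rewrite coprimep_div_gcd // b0 orbT.
apply/eqP; rewrite eqr_div ?tofrac_eq0 // -!tofracM tofrac_eq.
by rewrite {1}Ea {2}Eb mulrAC mulrA.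
Qed.

Definition cstf (c : k) : K := (c%:P)%:F.

Definition evf (v : K) (A : {poly k}) : K :=
  (map_poly (@FracField.tofrac {poly k} \o polyC) A).[v].

Lemma evfD v A B : evf v (A + B) = evf v A + evf v B.
Proof. by rewrite /evf rmorphD hornerD. Qed.

Lemma evfB v A B : evf v (A - B) = evf v A - evf v B.
Proof. by rewrite /evf rmorphB hornerD hornerN. Qed.

Lemma evfM v A B : evf v (A * B) = evf v A * evf v B.
Proof. by rewrite /evf rmorphM hornerM. Qed.

Lemma evfC v c : evf v c%:P = cstf c.
Proof. by rewrite /evf map_polyC hornerC. Qed.

Lemma evfX v : evf v 'X = v.
Proof. by rewrite /evf map_polyX hornerX. Qed.

Lemma map_tofrac_polyC (p : {poly k}) :
  map_poly (@FracField.tofrac {poly k} \o polyC) p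
    = map_poly (@FracField.tofrac {poly k}) (map_poly polyC p).
Proof. by rewrite map_poly_comp. Qed.

Lemma frac_eq_cst (p q : {poly k}) c : q != 0 ->
  (p%:F / q%:F = cstf c) <-> (p = c *: q).
Proof.
move=> q0; have q0F : q%:F != 0 by rewrite tofrac_eq0.
rewrite -mul_polyC; split=> [/(congr1 (fun z => z * q%:F))|->].
  by rewrite mulfVK // -tofracM => /eqP; rewrite tofrac_eq => /eqP.
by rewrite tofracM mulfK.
Qed.

(** The field $k(v)$ generated by [v] over the constants. *)
Definition genf (v f : K) := exists A B, evf v B != 0 /\ f = evf v A / evf v B.

Lemma genf_ev v A : genf v (evf v A).
Proof. by exists A, 1; rewrite evfC divr1 /cstf tofrac1 oner_eq0. Qed.

Lemma subfield_genf v : subfield_pred (genf v).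
Proof.
split.
- by exists 1, 1; rewrite evfC /cstf tofrac1 divr1 oner_eq0.
- move=> _ _ [A [B [B0 ->]]] [A' [B' [B'0 ->]]].
  exists (A * B' - A' * B), (B * B').
  split.
    rewrite evfM.
    exact: (mulf_neq0 B0 B'0).
  by rewrite evfB !(evfM v) -mulNr (addf_div _ _ B0 B'0) mulNr.
- move=> _ _ [A [B [B0 ->]]] [A' [B' [B'0 ->]]].
  exists (A * A'), (B * B'); split; first by rewrite evfM; exact: (mulf_neq0 B0 B'0).
  by rewrite !(evfM v) mulf_div.
move=> _ [A [B [B0 ->]]]; rewrite invf_div.
have [->|A0] := eqVneq (evf v A) 0.
  exists 0, 1; rewrite !evfC /cstf tofrac1 tofrac0 invr0 mulr0 mul0r.
  by rewrite oner_eq0.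
by exists B, A.
Qed.

Lemma genf_cst v c : genf v (cstf c).
Proof. by rewrite -(evfC v); apply: genf_ev. Qed.

Lemma subfield_ev (E : K -> Prop) v A :
  subfield_pred E -> (forall c, E (cstf c)) -> E v -> E (evf v A).
Proof.
move=> sE Ec Ev; elim/poly_ind: A => [|A c EA]; first by rewrite evfC.
rewrite evfD evfM evfX evfC; apply: subfieldD => //.
exact: subfieldM.
Qed.

Lemma genf_trans u v f : genf u v -> genf v f -> genf u f.
Proof.
move=> uv [A [B [B0 ->]]].
by apply: subfield_div; first exact: subfield_genf;
   apply: subfield_ev => //; [exact: subfield_genf|exact: genf_cst|
                              exact: subfield_genf|exact: genf_cst].
Qed.

Lemma clear_denominators (P : {poly K}) : exists (d : {poly k}) G,
  d != 0 /\ map_poly (@FracField.tofrac {poly k}) G = d%:F *: P.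
Proof.
elim/poly_ind: P => [|P c [d [G [d0 EG]]]].
  by exists 1, 0; rewrite oner_eq0 rmorph0 scaler0.
have [a [b [b0 ->]]] := fracP c.
exists (d * b), (b%:P * G * 'X + (d * a)%:P); split; first by rewrite mulf_neq0.
rewrite rmorphD !rmorphM /= !map_polyC map_polyX EG /= scalerDr.
congr (_ + _).
  by rewrite mul_polyC scalerA [RHS]scalerAl [b%:F * _]mulrC.
have b0F : b%:F != 0 by rewrite tofrac_eq0.
rewrite -[LHS]polyCM -[X in _ *: X]polyCM -[RHS]mul_polyC -[RHS]polyCM.
congr (_ %:P).
by rewrite mulrACA (divff b0F) mulr1.
Qed.

End Fractions.

(** * Lüroth's theorem *)

Section Luroth.
Variable k : closedFieldType.
Local Notation K := {fraction {poly k}}.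
Local Notation "x %:F" := (@FracField.tofrac {poly k} x).
Local Notation "P ^F" := (map_poly (@FracField.tofrac {poly k}) P) (at level 2).

Lemma map_tofrac_inj : injective (map_poly (@FracField.tofrac {poly k})).
Proof.
by apply: map_inj_poly; rewrite ?tofrac0 // => a b /eqP; rewrite tofrac_eq => /eqP.
Qed.

Lemma map_tofrac_mulC (a : {poly k}) (P : {poly {poly k}}) :
  (a%:P * P)^F = a%:F *: P^F.
Proof. by rewrite [LHS]rmorphM /= map_polyC /= [LHS]mul_polyC. Qed.

Definition nonproportional (p q : {poly k}) := forall c, p <> c *: q.

(* [fibre_poly p q] vanishes at [(x, t)] when [p / q] takes the same value at
   [x] (the inner variable) and at [t] (the outer one). *)
Definition fibre_poly (p q : {poly k}) : {poly {poly k}} :=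
  q%:P * map_poly polyC p - p%:P * map_poly polyC q.

Lemma coef_fibre_poly p q j : (fibre_poly p q)`_j = p`_j *: q - q`_j *: p.
Proof. by rewrite coefB !coefCM !coef_map /= ![_ * _%:P]mulrC !mul_polyC. Qed.

(** The coefficient of degree [n.-1], with [n] the larger size, is a combination of [p] and [q]
    whose weights are not both zero, so it cannot vanish. *)
Lemma size_fibre_poly p q : q != 0 -> nonproportional p q ->
  (maxn (size p) (size q) <= size (fibre_poly p q))%N.
Proof.
move=> q0 npq; rewrite leqNgt; apply/negP => lt_s.
set n := maxn _ _ in lt_s; have n_gt0 : (0 < n)%N by apply: leq_ltn_trans lt_s.
have := @nth_default _ 0 (fibre_poly p q) n.-1; rewrite coef_fibre_poly.
rewrite -ltnS prednK // lt_s => /(_ isT)/eqP; rewrite subr_eq0 => /eqP E.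
have [q_n|q_n] := eqVneq q`_n.-1 0; last first.
  by case: (npq (p`_n.-1 / q`_n.-1)); rewrite mulrC -scalerA E scalerA mulVf // scale1r.
move: E; rewrite q_n scale0r => /eqP; rewrite scaler_eq0 (negPf q0) orbF => /eqP p_n.
have [sqp|spq] := leqP (size q) (size p).
  move: p_n; rewrite /n (maxn_idPl sqp) -/(lead_coef p) => /eqP.
  by rewrite lead_coef_eq0 => /eqP p0; case: (npq 0); rewrite p0 scale0r.
move: q_n; rewrite /n (maxn_idPr (ltnW spq)) -/(lead_coef q) => /eqP.
by rewrite lead_coef_eq0 (negPf q0).
Qed.

Lemma sizeY_fibre_poly p q : (sizeY (fibre_poly p q) <= maxn (size p) (size q))%N.
Proof.
apply/bigmax_leqP => j _; rewrite coef_fibre_poly.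
apply: leq_trans (size_polyD _ _) _; rewrite size_polyN maxnC.
by rewrite geq_max !leq_max !size_scale_leq orbT.
Qed.

(** A root at the constant [t] would make [p] and [q] proportional unless both vanish at [t], which
    coprimality excludes. *)
Lemma fibre_poly_no_root p q t : coprimep p q -> q != 0 -> nonproportional p q ->
  (fibre_poly p q).[t%:P] != 0.
Proof.
move=> cpq q0 npq; rewrite hornerD hornerN !hornerM !hornerC.
have hm (r : {poly k}) : (map_poly polyC r).[t%:P] = r.[t]%:P by rewrite horner_map.
rewrite !hm subr_eq0 ![_ * _%:P]mulrC !mul_polyC; apply/eqP => E.
have [q_t|q_t] := eqVneq q.[t] 0; last first.
  by case: (npq (p.[t] / q.[t])); rewrite mulrC -scalerA E scalerA mulVf // scale1r.
move: E; rewrite q_t scale0r => /eqP.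
rewrite scaler_eq0 (negPf q0) orbF => p_t.
by move: (coprimep_root cpq p_t); rewrite q_t eqxx.
Qed.

(** * Non-constant elements of least degree *)

Section MinimalDegree.
Variables (E : K -> Prop) (sE : subfield_pred E) (Ec : forall c, E (cstf c)).
Variables (p q : {poly k}).
Hypotheses (q0 : q != 0) (cpq : coprimep p q) (npq : nonproportional p q).
Hypothesis Epq : E (p%:F / q%:F).
Hypothesis min_pq : forall a b, b != 0 -> nonproportional a b -> E (a%:F / b%:F) ->
  (maxn (size p) (size q) <= maxn (size a) (size b))%N.

(* The coefficients of [G] cannot all be proportional, and a non-constant ratio
   of two of them has degree at least that of [p / q]. *)
Lemma sizeY_relation (G : {poly {poly k}}) : G != 0 -> G.['X] = 0 ->
  (forall j, E ((G`_j)%:F / (lead_coef G)%:F)) ->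
  (maxn (size p) (size q) <= sizeY G)%N.
Proof.
move=> G0 GX EG; rewrite leqNgt; apply/negP => ltG.
have lG0 : lead_coef G != 0 by rewrite lead_coef_eq0.
have /choice[c Gc] : forall j, exists c, G`_j = c *: lead_coef G.
  move=> j; apply: contrapT => /forallNP npj.
  have := min_pq lG0 npj (EG j); rewrite leqNgt => /negP; apply.
  apply: leq_ltn_trans ltG; rewrite geq_max.
  by rewrite max_size_coefXY max_size_lead_coefXY.
(* With proportional coefficients, [G] is a polynomial in $x$ times a polynomial [N] in $t$, and
   $G(x, x) = 0$ forces [N = 0]. *)
pose N := \poly_(j < size G) c j.
have GN : G = (lead_coef G)%:P * map_poly polyC N.
  apply/polyP => j; rewrite coefCM coef_map coef_poly /=.
  case: ltnP => sj; first by rewrite Gc mulrC mul_polyC.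
  by rewrite nth_default // mulr0.
move: GX; rewrite GN hornerM hornerC => /eqP.
rewrite mulf_eq0 (negPf lG0) /= => /eqP N0.
have N0' : N = 0 by rewrite -[RHS]N0 -[LHS]comp_polyXr.
by move/eqP: G0; apply; rewrite GN N0' rmorph0 mulr0.
Qed.

(** This is $p(t) - v q(t)$ with $v = p/q$: it differs from [fibre_poly] by the factor [q], and its
    coefficients lie in $k(v)$. *)
Definition fibre_frac : {poly K} := (map_poly polyC p)^F - (p%:F / q%:F) *: (map_poly polyC q)^F.

Lemma fibre_fracE : (fibre_poly p q)^F = q%:F *: fibre_frac.
Proof.
have q0F : q%:F != 0 by rewrite tofrac_eq0.
rewrite [LHS]rmorphB /= !map_tofrac_mulC /fibre_frac [RHS]scalerBr scalerA.
by rewrite [q%:F * _]mulrC (mulfVK q0F).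
Qed.

Lemma E_fibre_frac j : E fibre_frac`_j.
Proof.
rewrite coefB coefZ !coef_map /=.
by apply: (subfieldB sE); [exact: Ec|apply: (subfieldM sE); [exact: Epq|exact: Ec]].
Qed.

Lemma map_tofracX (G : {poly {poly k}}) : G^F.['X%:F] = (G.['X])%:F.
Proof. exact: horner_map. Qed.

Lemma root_fibre_frac : fibre_frac.['X%:F] = 0.
Proof.
have q0F : q%:F != 0 by rewrite tofrac_eq0.
apply/eqP; have := congr1 (fun P : {poly K} => P.['X%:F]) fibre_fracE.
rewrite map_tofracX hornerZ hornerD hornerN !hornerM !hornerC.
have hm (r : {poly k}) : (map_poly polyC r).['X] = r by exact: comp_polyXr.
rewrite !hm mulrC subrr tofrac0 => /esym/eqP.
by rewrite mulf_eq0 (negPf q0F).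
Qed.

Definition relation (M : {poly K}) :=
  [/\ M != 0, forall j, E M`_j & M.['X%:F] = 0].

(* The primitive form [G] of the minimal relation divides [fibre_poly p q]; since
   its degree in [x] is already maximal, the cofactor is a polynomial in [t]
   alone, and [fibre_poly p q] has no such factor. *)
Lemma size_relation M : relation M -> (maxn (size p) (size q) <= size M)%N.
Proof.
have [n] := ubnP (size M); elim: n => // n IH in M *.
rewrite ltnS => sM relM.
(* A smaller relation falls under the induction hypothesis, so [M] may be taken of least size; then
   the remainder of [fibre_frac] modulo [M] must be zero. *)
have [minM|] := pselect (forall N, relation N -> (size M <= size N)%N); last first.
  move=> /existsNP[N /not_implyP[relN /negP]]; rewrite -ltnNge => ltN.
  by apply: leq_trans (IH _ (leq_trans ltN sM) relN) (ltnW ltN).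
have [M0 EM MX] := relM.
have [Q [sQ EQ]] := subfield_edivp sE M0 EM E_fibre_frac.
have PQ : fibre_frac = Q * M.
  apply/eqP; rewrite -subr_eq0; apply: contraT => r0.
  have /minM : relation (fibre_frac - Q * M); last by rewrite leqNgt sQ.
  split=> //.
  by rewrite hornerD hornerN hornerM root_fibre_frac MX mulr0 subrr.
have [d [G1 [d0 EG1]]] := clear_denominators M.
have [h [H [h0 EH]]] := clear_denominators Q.
have d0F : d%:F != 0 by rewrite tofrac_eq0.
have sG1 : size G1 = size M.
  rewrite -(size_map_inj_poly (_ : injective (@FracField.tofrac {poly k}))) ?tofrac0 //.
    by rewrite EG1 size_scale.
  by move=> a b /eqP; rewrite tofrac_eq => /eqP.
have G10 : G1 != 0 by rewrite -size_poly_eq0 sG1 size_poly_eq0.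
have [c [G [c0 pG G1E]]] := primitive_part G10.
have G0 : G != 0 by apply: contraNneq G10 => G0; rewrite G1E G0 mulr0.
have sG : size G = size M by rewrite -sG1 G1E mul_polyC size_scale.
have GX : G.['X] = 0.
  have : G1.['X] = 0.
    by apply/eqP; rewrite -tofrac_eq0 -map_tofracX EG1 hornerZ MX mulr0.
  by rewrite G1E hornerM hornerC => /eqP; rewrite mulf_eq0 (negPf c0) => /eqP.
have EG j : E ((G`_j)%:F / (lead_coef G)%:F).
  have cG i : c%:F * (G`_i)%:F = d%:F * M`_i.
    by rewrite -tofracM -coefCM -G1E -coef_map EG1 coefZ.
  have c0F : c%:F != 0 by rewrite tofrac_eq0.
  have -> : (G`_j)%:F / (lead_coef G)%:F = M`_j / lead_coef M.
    have lM : lead_coef M != 0 by rewrite lead_coef_eq0.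
    have lG : (lead_coef G)%:F != 0 by rewrite tofrac_eq0 lead_coef_eq0.
    apply/eqP; rewrite (eqr_div _ _ lG lM); apply/eqP.
    apply: (mulfI c0F); rewrite mulrA cG mulrCA {2}/lead_coef cG -/(lead_coef G).
    by rewrite sG -/(lead_coef M) mulrCA mulrA.
  by apply: (subfield_div sE); [exact: EM|exact: EM].
(* The factorisation of [fibre_frac], multiplied by [q * d * h], is an identity in $k[x][t]$, from
   which [gauss] removes [d * h]. *)
have FGH : (d * h)%:P * fibre_poly p q = G * ((q * c)%:P * H).
  apply: map_tofrac_inj; rewrite map_tofrac_mulC fibre_fracE PQ.
  have -> : G * ((q * c)%:P * H) = q%:P * (G1 * H).
    by rewrite G1E polyCM mulrCA -!mulrA; congr (_ * _); rewrite mulrCA.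
  rewrite map_tofrac_mulC [(G1 * H)^F]rmorphM /= EG1 EH.
  rewrite -[d%:F *: M * _]scalerAl -[M * _]scalerAr !scalerA [Q * M]mulrC.
  by congr (_ *: _); rewrite tofracM mulrC mulrA.
have dh0 : d * h != 0 by rewrite mulf_neq0.
have [H' FG] := gauss pG dh0 FGH.
have F0 : fibre_poly p q != 0.
  apply: contraTneq (fibre_poly_no_root 0 cpq q0 npq) => ->.
  by rewrite horner0 eqxx.
have H'0 : H' != 0 by apply: contraNneq F0 => H'0; rewrite FG H'0 mulr0.
have [N HN] : exists N : {poly k}, H' = map_poly polyC N.
  have := sizeY_fibre_poly p q; rewrite FG sizeYE rmorphM /=.
  rewrite size_mul ?swapXY_eq0 // -!sizeYE => leY.
  have := leq_trans leY (sizeY_relation G0 GX EG).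
  have : (0 < sizeY G)%N by rewrite lt0n sizeY_eq0.
  case: (sizeY G) => // s _; rewrite addSn /= -(addn1 s) leq_add2l => s1.
  exists (swapXY H')`_0; rewrite -swapXY_polyC -size1_polyC ?swapXYK //.
  by rewrite -sizeYE.
have sN : size N == 1.
  apply: contraT => /closed_rootP[t Nt].
  have := fibre_poly_no_root t cpq q0 npq; rewrite FG HN hornerM.
  by rewrite (_ : (map_poly _ N).[_] = N.[t]%:P) ?horner_map // (eqP Nt) mulr0 eqxx.
rewrite -sG; apply: leq_trans (size_fibre_poly q0 npq) _.
have [e e0 Ne] := size_poly1P _ sN.
by rewrite FG HN Ne map_polyC /= mulrC mul_polyC size_scale // polyC_eq0.
Qed.

(* Reducing the numerator and the denominator of [f] modulo [fibre_frac] gives two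
   polynomials over [k(p / q)] that are proportional with ratio [f]. *)
Lemma genf_minimal f : E f -> genf (p%:F / q%:F) f.
Proof.
move=> Ef; set v := p%:F / q%:F.
have sC := subfield_genf v; have Cc := @genf_cst k v.
have Cv : genf v v by have := genf_ev v 'X; rewrite evfX.
have CE g : genf v g -> E g.
  by move=> [A [B [_ ->]]]; apply: (subfield_div sE); apply: subfield_ev.
have P0 : fibre_frac != 0.
  have := fibre_poly_no_root 0 cpq q0 npq; apply: contraNneq => P0.
  have : (fibre_poly p q)^F = 0 by rewrite fibre_fracE P0 scaler0.
  by rewrite -[RHS](rmorph0 (map_poly (@FracField.tofrac {poly k})))
       => /map_tofrac_inj ->; rewrite horner0.
have CP j : genf v fibre_frac`_j.
  rewrite coefB coefZ !coef_map /=.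
  apply: (subfieldB sC); first exact: Cc.
  by apply: (subfieldM sC); [exact: Cv|exact: Cc].
have red (a : {poly k}) : exists r : {poly K},
    [/\ (size r < size fibre_frac)%N, forall j, genf v r`_j & r.['X%:F] = a%:F].
  have Ca j : genf v ((map_poly polyC a)^F)`_j by rewrite !coef_map /=; exact: Cc.
  have [Q [sQ CQ]] := subfield_edivp sC P0 CP Ca.
  exists ((map_poly polyC a)^F - Q * fibre_frac); split=> //.
  rewrite hornerD hornerN hornerM root_fibre_frac mulr0 subr0 map_tofracX.
  by congr (_ %:F); exact: comp_polyXr.
have sP : (size fibre_frac <= maxn (size p) (size q))%N.
  have sm (r : {poly k}) : size ((map_poly polyC r)^F) = size r.
    by rewrite -map_tofrac_polyC size_map_poly.
  apply: leq_trans (size_polyD _ _) _; rewrite size_polyN sm geq_max leq_maxl /=.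
  by apply: leq_trans (size_scale_leq _ _) _; rewrite sm leq_maxr.
have [a [b [b0 fE]]] := fracP f.
have [ra [sra Cra raX]] := red a.
have [rb [srb Crb rbX]] := red b.
have b0F : b%:F != 0 by rewrite tofrac_eq0.
(* The difference vanishes at $x$ and lies over [E], but its size is below the bound of
   [size_relation]. *)
have rab : ra = f *: rb.
  apply/eqP; rewrite -subr_eq0; apply: contraT => r0.
  have /size_relation : relation (ra - f *: rb).
    split=> // [j|].
      rewrite coefB coefZ; apply: (subfieldB sE); first exact: (CE _ (Cra j)).
      by apply: (subfieldM sE); [exact: Ef|exact: (CE _ (Crb j))].
    by rewrite hornerD hornerN hornerZ raX rbX fE (mulfVK b0F) subrr.
  rewrite leqNgt => /negP; case; apply: leq_trans sP.
  apply: leq_ltn_trans (size_polyD _ _) _; rewrite size_polyN gtn_max sra /=.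
  exact: leq_ltn_trans (size_scale_leq _ _) srb.
have rb0 : rb != 0.
  by apply: contraNneq b0F => rb0; rewrite -rbX rb0 horner0.
have lb0 : lead_coef rb != 0 by rewrite lead_coef_eq0.
have -> : f = ra`_(size rb).-1 / lead_coef rb by rewrite rab coefZ (mulfK lb0).
by apply: (subfield_div sC); [exact: Cra|exact: Crb].
Qed.

End MinimalDegree.

(** The larger of the two sizes measures the degree of a fraction; lowest terms do not raise it, so
    a non-constant element of least degree can be written with [p] and [q] coprime. *)
Theorem luroth (E : K -> Prop) (f : K) : subfield_pred E -> (forall c, E (cstf c)) ->
  E f -> (forall c, f <> cstf c) ->
  exists v, [/\ E v, forall c, v <> cstf c & forall g, E g -> genf v g].
Proof.
move=> sE Ec Ef fc.
pose admissible n := `[< exists p q, [/\ q != 0, nonproportional p q,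
  E (p%:F / q%:F) & maxn (size p) (size q) = n] >].
have ex_adm : exists n, admissible n.
  have [a [b [b0 fE]]] := fracP f; exists (maxn (size a) (size b)).
  apply/asboolP; exists a, b; split=> //; last by rewrite -fE.
  by move=> c /(frac_eq_cst _ _ b0); rewrite -fE; exact: fc.
have := ex_minnP ex_adm => -[n /asboolP[a [b [b0 nab Eab sab]]] minn].
have [p [q [q0 cpq ab sp sq]]] := frac_coprime a b0.
have npq : nonproportional p q.
  by move=> c /(frac_eq_cst _ _ q0); rewrite -ab => /(frac_eq_cst _ _ b0); exact: nab.
exists (p%:F / q%:F); split=> [|c /(frac_eq_cst _ _ q0)|g Eg]; first by rewrite -ab.
  exact: npq.
apply: (genf_minimal sE Ec q0 cpq npq) => //; first by rewrite -ab.
move=> a' b' b'0 na'b' Ea'b'; apply: (@leq_trans n).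
  by rewrite -sab geq_max !leq_max sp sq orbT.
by apply: minn; apply/asboolP; exists a', b'.
Qed.

End Luroth.

(** * Sets on which conjugation is rational *)

Section Reversal.
Variable F : fieldType.

(** The reciprocal polynomial $u^{d-1} P(1/u)$; a free [d] lets two polynomials be reversed to the
    same length. *)
Definition revp d (P : {poly F}) := \poly_(i < d) P`_(d.-1 - i).

Lemma horner_revp d (P : {poly F}) u : (size P <= d)%N -> u != 0 ->
  (revp d P).[u] = u ^+ d.-1 * P.[u^-1].
Proof.
move=> sP u0; rewrite horner_poly (horner_coef_wide _ sP) mulr_sumr.
rewrite (reindex_inj rev_ord_inj) /=; apply: eq_bigr => i _.
have id1 : (i <= d.-1)%N by rewrite -ltnS (ltn_predK (ltn_ord i)).
have E : (d - i.+1 = d.-1 - i)%N by rewrite subnS -subn1 subnAC subn1.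
rewrite E subKn // mulrCA; congr (_ * _).
by rewrite exprB // ?unitfE // exprVn.
Qed.

Lemma revp_eq0 (P : {poly F}) : (revp (size P) P == 0) = (P == 0).
Proof.
apply/eqP/eqP => [|->]; last by rewrite /revp size_poly0 poly_def big_ord0.
move/(congr1 (fun p : {poly F} => p`_0)); rewrite coef_poly coef0 subn0.
rewrite size_poly_gt0; case: eqVneq => //= P0 /eqP.
by rewrite -/(lead_coef P) lead_coef_eq0 (negPf P0).
Qed.

End Reversal.

Section Schwarz.
Variable R : realType.
Local Notation C := R[i].

(** For subsets of the complex line this means infinite; in this form, poles and other exceptional
    points are discarded as roots of one [e]. *)
Definition zariski_dense (T : C -> Prop) :=
  forall e : {poly C}, e != 0 -> exists t, T t /\ e.[t] != 0.

Lemma zariski_eq0 T (P e : {poly C}) : zariski_dense T -> e != 0 ->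
  (forall t, T t -> e.[t] != 0 -> P.[t] = 0) -> P = 0.
Proof.
move=> dT e0 PT; apply/eqP; apply: contraT => P0.
have [t [Tt]] := dT (P * e) (mulf_neq0 P0 e0).
rewrite hornerM mulf_eq0 negb_or => /andP[/eqP Pt et].
by case: Pt; exact: PT.
Qed.

Definition conjp (P : {poly C}) : {poly C} := map_poly Num.conj P.

Lemma horner_conjp P x : (conjp P).[x^*] = P.[x]^*.
Proof. exact: horner_map. Qed.

Lemma size_conjp P : size (conjp P) = size P.
Proof. exact: size_map_poly. Qed.

(** A general [phi] covers both evaluation at a point and the embedding into the field of fractions.
    The size bound keeps [n - i] from being truncated. *)
Lemma morph_homog_comp (L : fieldType) (phi : {rmorphism {poly C} -> L}) n
    (A p q : {poly C}) : (size A <= n.+1)%N -> phi q != 0 ->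
  phi (homog_comp n A p q)
    = phi q ^+ n * (map_poly (phi \o polyC) A).[phi p / phi q].
Proof.
move=> sA qx; rewrite /homog_comp rmorph_sum /=.
have sA' : (size (map_poly (phi \o polyC) A) <= size A)%N by exact: size_poly.
rewrite (horner_coef_wide _ sA') mulr_sumr; apply: eq_bigr => i _.
rewrite -mul_polyC !rmorphM !rmorphXn /= coef_map /= [RHS]mulrCA; congr (_ * _).
have le_in : (i <= n)%N by rewrite -ltnS (leq_trans (ltn_ord i)).
by rewrite expr_div_n [RHS]mulrCA; congr (_ * _); rewrite expfB_cond ?(negPf qx).
Qed.

Lemma horner_homog_comp n (A p q : {poly C}) x : (size A <= n.+1)%N -> q.[x] != 0 ->
  (homog_comp n A p q).[x] = q.[x] ^+ n * A.[p.[x] / q.[x]].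
Proof.
move=> sA qx; rewrite -[LHS]/(horner_eval x _) morph_homog_comp //.
by congr (_ * _.[_]); apply: map_poly_id => c _ /=; rewrite /horner_eval hornerC.
Qed.

Lemma dvdp_homog_comp n (A p q : {poly C}) : (size A <= n)%N -> q %| homog_comp n A p q.
Proof.
move=> sA; rewrite /homog_comp; elim/big_ind: _ => [|x y|i _]; [exact: dvdp0|exact: dvdp_add|].
rewrite -mul_polyC; apply/dvdp_mull/dvdp_mull/dvdp_exp => //.
by rewrite subn_gt0; apply: leq_trans sA.
Qed.

(* The equation [u^* = N u / D u] is substituted into its own conjugate; modulo
   [D] (made coprime to [N]) only a power of [N] survives, so [D] is constant. *)
Lemma schwarz_affine (U : C -> Prop) (N D : {poly C}) : zariski_dense U ->
  (size D < size N)%N -> (forall u, U u -> u^* * D.[u] = N.[u]) ->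
  exists a b e, e != 0 /\ forall u, U u -> e.[u] != 0 -> u^* = a * u + b.
Proof.
move=> dU sDN UND.
have N0 : N != 0 by rewrite -size_poly_gt0; apply: leq_trans sDN.
have D0 : D != 0.
  apply: contraNneq N0 => D0; apply/eqP/(zariski_eq0 dU (oner_neq0 _)) => u Uu _.
  by rewrite -UND // D0 horner0 mulr0.
pose g := gcdp N D.
have g0 : g != 0 by rewrite gcdp_eq0 negb_and D0 orbT.
set N' := N %/ g; set D' := D %/ g.
have EN : N = N' * g by rewrite divpK // dvdp_gcdl.
have ED : D = D' * g by rewrite divpK // dvdp_gcdr.
have D'0 : D' != 0 by apply: contraNneq D0 => D'0; rewrite ED D'0 mul0r.
have N'0 : N' != 0 by apply: contraNneq N0 => N'0; rewrite EN N'0 mul0r.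
have cND : coprimep N' D' by rewrite coprimep_div_gcd // D0 orbT.
have sD'N' : (size D' < size N')%N.
  move: sDN; rewrite EN ED !size_mul //.
  by move: g0; rewrite -size_poly_gt0; case: (size g) => // s _; rewrite !addnS /= ltn_add2r.
have UND' u : U u -> g.[u] != 0 -> u^* * D'.[u] = N'.[u].
  by move=> Uu gu; apply: (mulIf gu); rewrite -mulrA -!hornerM -EN -ED UND.
pose n := (size N').-1.
have nE : size N' = n.+1 by rewrite prednK // size_poly_gt0.
have sD'n : (size D' <= n)%N by rewrite -ltnS -nE.
(* Conjugating $\bar u D'(u) = N'(u)$ and inserting $\bar u = N'(u)/D'(u)$ gives this identity at
   almost all points of [U], after multiplication by $D'(u)^n$. *)
have hom_eq : 'X * homog_comp n (conjp D') N' D' = homog_comp n (conjp N') N' D'.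
  apply/eqP; rewrite -subr_eq0; apply/eqP.
  apply: (zariski_eq0 dU (mulf_neq0 g0 D'0)) => u Uu.
  rewrite hornerM mulf_eq0 negb_or => /andP[gu D'u].
  rewrite hornerD hornerN hornerM hornerX !horner_homog_comp ?size_conjp ?nE //; last exact: leqW.
  have -> : N'.[u] / D'.[u] = u^* by rewrite -(UND' u Uu gu) mulfK.
  rewrite !horner_conjp -(UND' u Uu gu) rmorphM /= conjCK mulrCA.
  by rewrite subrr.
have dD'N' : D' %| N' ^+ n.
  have : D' %| homog_comp n (conjp N') N' D'.
    by rewrite -hom_eq dvdp_mull // dvdp_homog_comp // size_conjp.
  rewrite /homog_comp size_conjp nE big_ord_recr /= dvdp_addr.
    rewrite subnn expr0 mulr1 dvdpZr // coef_map /= conjC_eq0.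
    by move: N'0; rewrite -lead_coef_eq0 /lead_coef nE.
  elim/big_ind: _ => [|x y|i _]; [exact: dvdp0|exact: dvdp_add|].
  rewrite -mul_polyC; apply/dvdp_mull/dvdp_mull/dvdp_exp => //.
  by rewrite subn_gt0.
have /size_poly1P[c c0 D'c] : size D' == 1.
  rewrite size_poly_eq1; move/coprimepP: (coprimep_expl n cND); exact.
pose S := c^-1 *: N'.
have US u : U u -> g.[u] != 0 -> u^* = S.[u].
  by move=> Uu gu; rewrite hornerZ -(UND' u Uu gu) D'c hornerC mulrC mulfK.
(* Conjugation is an involution; since degrees multiply under composition, [S] must be affine. *)
have SS : conjp S \Po S = 'X.
  apply/eqP; rewrite -subr_eq0; apply/eqP/(zariski_eq0 dU g0) => u Uu gu.
  by rewrite hornerD hornerN hornerX horner_comp -US // horner_conjp -US // conjCK subrr.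
have sS : size S = 2.
  have := size_comp_poly (conjp S) S; rewrite SS size_polyX size_conjp /=.
  by case: (size S) => [|[|[|m]]].
exists S`_1, S`_0, g; split=> // u Uu gu.
by rewrite US // horner_coef sS !big_ord_recl big_ord0 /= addr0 mulr1 addrC.
Qed.

(* Sending a point [t0] of [T] to infinity makes the rational function that
   expresses conjugation have a pole at infinity, as [schwarz_affine] needs. *)
Lemma schwarz_circle (T : C -> Prop) (A B : {poly C}) : zariski_dense T ->
  B != 0 -> (forall t, T t -> t^* * B.[t] = A.[t]) ->
  exists t0 l m e, [/\ l != 0, e != 0 &
    forall t, T t -> e.[t] != 0 -> t != t0 /\ l / (t - t0) + m \is Num.real].
Proof.
move=> dT B0 TAB.
have [t0 [Tt0 Bt0]] := dT _ B0.
(* On [T] this gives $(\bar t - \bar t_0) B(t) = (t - t_0) A_1(t)$, that is, $\bar u A'(1/u) = u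
   B'(1/u)$ for $u = 1/(t - t_0)$. *)
have /factor_theorem[A1 EA1] : root (A - t0^* *: B) t0.
  by rewrite /root hornerD hornerN hornerZ TAB // subrr.
pose A' := A1 \Po ('X + t0%:P); pose B' := B \Po ('X + t0%:P).
have sX : size ('X + t0%:P) = 2 by rewrite size_XaddC.
have sXm : size ('X - t0%:P) = 2 by rewrite size_XsubC.
have X0 : 'X - t0%:P != 0 by rewrite polyXsubC_eq0.
have B'0 : B' != 0 by rewrite comp_poly2_eq0.
pose d := maxn (size A') (size B').
have sA'd : (size A' <= d)%N by exact: leq_maxl.
have sB'd : (size B' <= d)%N by exact: leq_maxr.
have d0 : (0 < d)%N by apply: leq_trans sB'd; rewrite size_poly_gt0.
(* As $B'(0) = B(t_0)$ is non-zero, the reversal of [B'] has full size [d], and the factor ['X]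
   makes the numerator longer than the denominator. *)
have sN : size ('X * revp d B') = d.+1.
  have lB : B'`_(d.-1 - d.-1) != 0.
    rewrite subnn -horner_coef0 horner_comp.
    by rewrite hornerD hornerX hornerC add0r.
  have sr : size (revp d B') = d.
    by rewrite /revp -{1}(prednK d0) size_poly_eq ?prednK.
  by rewrite mulrC size_mulX ?sr // -size_poly_gt0 sr.
pose U u := exists t, [/\ T t, t != t0 & u = (t - t0)^-1].
(* The pullback of [e] along $t \mapsto 1/(t - t_0)$, with a factor that excludes [t0]. *)
pose pull (e : {poly C}) := (revp (size e) e \Po ('X - t0%:P)) * ('X - t0%:P).
have pull0 e : e != 0 -> pull e != 0.
  by move=> e0; rewrite mulf_neq0 // comp_poly2_eq0 // revp_eq0.
have pullP e t : (pull e).[t] != 0 -> t != t0 /\ e.[(t - t0)^-1] != 0.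
  rewrite hornerM mulf_eq0 negb_or horner_comp !hornerXsubC => /andP[+ tt0].
  rewrite horner_revp // mulf_eq0 negb_or => /andP[_ et].
  by split; first by rewrite -subr_eq0.
have dU : zariski_dense U.
  move=> e e0; have [t [Tt /pullP[tt0 et]]] := dT _ (pull0 e e0).
  by exists (t - t0)^-1; split=> //; exists t.
have UND u : U u -> u^* * (revp d A').[u] = ('X * revp d B').[u].
  move=> [t [Tt tt0 ->]].
  have s0 : t - t0 != 0 by rewrite subr_eq0.
  rewrite hornerM hornerX !horner_revp ?invr_eq0 // invrK !horner_comp.
  rewrite !hornerD !hornerX !hornerC subrK mulrCA [RHS]mulrCA; congr (_ * _).
  apply: (mulIf s0); rewrite -mulrA -(hornerXsubC t0) -hornerM -EA1 hornerXsubC.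
  rewrite hornerD hornerN hornerZ -TAB // -mulrBl -rmorphB fmorphV /= mulKf ?conjC_eq0 //.
  by rewrite mulrAC mulVf // mul1r.
have [|a [b [e [e0 Uab]]]] := @schwarz_affine U ('X * revp d B') (revp d A') dU _ UND.
  by rewrite sN ltnS; apply: size_poly.
have [u1 [Uu1 eu1]] := dU e e0.
have [|u2 [Uu2]] := dU (e * ('X - u1%:P)).
  by rewrite mulf_neq0 // polyXsubC_eq0.
rewrite hornerM hornerXsubC mulf_eq0 negb_or => /andP[eu2 u21].
(* The relation $\bar u = a u + b$ puts [u] on a line; $(u - u_1)/(u_2 - u_1)$ is real because [a]
   cancels in its conjugate. *)
exists t0, (u2 - u1)^-1, (- u1 / (u2 - u1)), (pull e); split=> //.
- by rewrite invr_eq0.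
- exact: pull0.
move=> t Tt /pullP[tt0 et]; split=> //.
have Uu : U (t - t0)^-1 by exists t.
move: (t - t0)^-1 Uu et => u Uu eu; rewrite mulrC -mulrDl.
have conjB v : U v -> e.[v] != 0 -> (v - u1)^* = a * (v - u1).
  by move=> Uv ev; rewrite rmorphB /= !Uab // mulrBr opprD addrACA subrr addr0.
have a0 : a != 0.
  apply: contraNneq u21 => a0; have := conjB u2 Uu2 eu2.
  by rewrite a0 mul0r => /eqP; rewrite conjC_eq0.
by apply/CrealP; rewrite rmorphM fmorphV /= !conjB // -mulf_div divff // mul1r.
Qed.

End Schwarz.

(** * Real generators *)

Section Constants.
Variable k : fieldType.
Local Notation K := {fraction {poly k}}.

Lemma evf_cst (c : k) (A : {poly k}) : evf (cstf c) A = cstf A.[c].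
Proof. by rewrite /evf -[RHS](horner_map (@FracField.tofrac {poly k} \o polyC)). Qed.

Lemma cstf_div (x y : k) : cstf (x / y) = cstf x / cstf y.
Proof. exact: (fmorph_div (@FracField.tofrac {poly k} \o polyC)). Qed.

Lemma genf_cst_l (c : k) (f : K) : genf (cstf c) f -> exists c', f = cstf c'.
Proof.
by move=> [A [B [_ ->]]]; exists (A.[c] / B.[c]); rewrite !evf_cst cstf_div.
Qed.

Lemma genf_mobius (v : K) (t l m : k) : l != 0 -> v != cstf t ->
  genf (cstf l / (v - cstf t) + cstf m) v.
Proof.
move=> l0 vt; set w := (X in genf X _).
have sw := subfield_genf w; have cw := @genf_cst k w.
have ww : genf w w by have := genf_ev w 'X; rewrite evfX.
have l0F : cstf l != 0 by rewrite tofrac_eq0 polyC_eq0.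
have -> : v = cstf t + cstf l / (w - cstf m).
  by rewrite /w addrK invf_div mulrCA (divff l0F) mulr1 addrC subrK.
apply: (subfieldD sw); first exact: cw.
apply: (subfield_div sw); first exact: cw.
by apply: (subfieldB sw); [exact: ww|exact: cw].
Qed.

End Constants.

(** A non-constant [v] is transcendental over [k]: [A] splits into linear factors, and a vanishing
    factor of $A(v)$ would make [v] constant. *)
Lemma evf_eq0 (k : closedFieldType) (v : {fraction {poly k}}) (A : {poly k}) :
  (forall c, v <> cstf c) -> evf v A = 0 -> A = 0.
Proof.
move=> vc; have [n] := ubnP (size A); elim: n => // n IH in A *.
rewrite ltnS => sA.
have [/size_poly1P[c c0 ->]|/closed_rootP[x /factor_theorem[A' AE]]] := boolP (size A == 1).
  by rewrite evfC => /eqP; rewrite tofrac_eq0 => /eqP.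
rewrite AE evfM evfB evfX evfC => /eqP; rewrite mulf_eq0 subr_eq0.
case/orP => [/eqP A'v|/eqP /vc//].
have [->|A'0] := eqVneq A' 0; first by rewrite mul0r.
rewrite (IH A') ?mul0r //.
by move: sA; rewrite AE size_Mmonic ?monicXsubC // size_XsubC addn2.
Qed.

Section Composition.
Variable R : realType.
Local Notation C := R[i].
Local Notation K := {fraction {poly C}}.
Local Notation "x %:F" := (@FracField.tofrac {poly C} x).

Lemma evf_homog_comp n (A p q : {poly C}) : (size A <= n.+1)%N -> q != 0 ->
  (homog_comp n A p q)%:F = q%:F ^+ n * evf (p%:F / q%:F) A.
Proof.
move=> sA q0; have q0F : q%:F != 0 by rewrite tofrac_eq0.
exact: morph_homog_comp.
Qed.

(** Clears denominators in an identity of rational functions; the result has the shape of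
    [ratf_eq_comp]. *)
Lemma homog_comp_frac n (a b A B p q : {poly C}) :
  (size A <= n.+1)%N -> (size B <= n.+1)%N -> b != 0 -> q != 0 ->
  evf (p%:F / q%:F) B != 0 ->
  a%:F / b%:F = evf (p%:F / q%:F) A / evf (p%:F / q%:F) B ->
  homog_comp n B p q != 0 /\ a * homog_comp n B p q = homog_comp n A p q * b.
Proof.
move=> sA sB b0 q0 vB abE.
have b0F : b%:F != 0 by rewrite tofrac_eq0.
have q0F : q%:F ^+ n != 0 by rewrite expf_eq0 tofrac_eq0 (negPf q0) andbF.
split.
  by rewrite -tofrac_eq0 (evf_homog_comp p sB q0); exact: (mulf_neq0 q0F vB).
apply/eqP; rewrite -tofrac_eq [X in X == _]tofracM [X in _ == X]tofracM.
rewrite (evf_homog_comp p sA q0) (evf_homog_comp p sB q0) mulrCA -mulrA.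
apply/eqP; congr (_ * _); apply/eqP.
by rewrite -(eqr_div _ _ b0F vB) abE.
Qed.

Lemma horner_frac n (a b A B p q : {poly C}) x :
  (size A <= n.+1)%N -> (size B <= n.+1)%N ->
  a * homog_comp n B p q = homog_comp n A p q * b ->
  b.[x] != 0 -> q.[x] != 0 -> (homog_comp n B p q).[x] != 0 ->
  B.[p.[x] / q.[x]] != 0 /\
  a.[x] / b.[x] = A.[p.[x] / q.[x]] / B.[p.[x] / q.[x]].
Proof.
move=> sA sB /(congr1 (fun P => P.[x])); rewrite !hornerM => E bx qx.
move: E; rewrite !horner_homog_comp // mulrCA -mulrA => /(mulfI (expf_neq0 _ qx)) E.
rewrite mulf_eq0 negb_or => /andP[_ Bt]; split=> //.
by apply/eqP; rewrite eqr_div // E.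
Qed.

Definition frac_image (X : C -> Prop) (e p q : {poly C}) : C -> Prop :=
  fun t => exists x, [/\ X x, e.[x] != 0, q.[x] != 0 & t = p.[x] / q.[x]].

(** The pullback $q^n g(p/q)$ of [g] is non-zero because [p / q] is transcendental, so some point of
    [X] avoids its roots. *)
Lemma zariski_dense_image X e p q : zariski_dense X -> e != 0 -> q != 0 ->
  nonproportional p q -> zariski_dense (frac_image X e p q).
Proof.
move=> dX e0 q0 npq g g0.
pose h := homog_comp (size g) g p q.
have h0 : h != 0.
  have vc c : p%:F / q%:F <> cstf c by move/(frac_eq_cst _ _ q0)/npq.
  have q0F : q%:F ^+ size g != 0 by rewrite expf_eq0 tofrac_eq0 (negPf q0) andbF.
  rewrite -tofrac_eq0 (evf_homog_comp p (leqnSn _) q0); apply: (mulf_neq0 q0F).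
  by apply/negP => /eqP /(evf_eq0 vc) /eqP; apply/negP.
have [x [Xx]] := dX (e * q * h) (mulf_neq0 (mulf_neq0 e0 q0) h0).
rewrite !hornerM !mulf_eq0 !negb_or => /andP[/andP[ex qx]].
rewrite horner_homog_comp // mulf_eq0 negb_or => /andP[_ gx].
by exists (p.[x] / q.[x]); split=> //; exists x.
Qed.

(* [a'] and [b'] are arbitrary polynomials, not the conjugates of [a] and [b]. *)
Definition conjugable (X : C -> Prop) (f : K) := exists a b a' b',
  [/\ b != 0, b' != 0, f = a%:F / b%:F & forall x, X x ->
      b.[x] != 0 -> b'.[x] != 0 -> (a.[x] / b.[x])^* = a'.[x] / b'.[x]].

Lemma conjugable_cst X c : conjugable X (cstf c).
Proof.
exists c%:P, 1, (c^*)%:P, 1; rewrite oner_eq0 tofrac1 divr1; split=> // x _ _ _.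
by rewrite !hornerC !divr1.
Qed.

(** Conjugation respects field operations, so they are performed on both fractions. For inverses,
    density shows that [a'] is non-zero when [a] is. *)
Lemma subfield_conjugable X : zariski_dense X -> subfield_pred (conjugable X).
Proof.
move=> dX; split.
- by rewrite -tofrac1; exact: conjugable_cst.
- move=> _ _ [a [b [a' [b' [b0 b'0 -> ab]]]]] [c [d [c' [d' [d0 d'0 -> cd]]]]].
  exists (a * d - c * b), (b * d), (a' * d' - c' * b'), (b' * d').
  have b0F : b%:F != 0 by rewrite tofrac_eq0.
  have d0F : d%:F != 0 by rewrite tofrac_eq0.
  split; rewrite ?mulf_neq0 //.
    by rewrite tofracB !tofracM -mulNr (addf_div _ _ b0F d0F) mulNr.
  move=> x Xx; rewrite !hornerM !mulf_eq0 !negb_or => /andP[bx dx] /andP[b'x d'x].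
  rewrite !(hornerD, hornerN, hornerM) -!mulNr -!addf_div // rmorphD /=.
  by rewrite !mulNr rmorphN /= ab // cd.
- move=> _ _ [a [b [a' [b' [b0 b'0 -> ab]]]]] [c [d [c' [d' [d0 d'0 -> cd]]]]].
  exists (a * c), (b * d), (a' * c'), (b' * d').
  split; rewrite ?mulf_neq0 //.
    by rewrite !tofracM mulf_div.
  move=> x Xx; rewrite !hornerM !mulf_eq0 !negb_or => /andP[bx dx] /andP[b'x d'x].
  by rewrite -!mulf_div rmorphM /= ab // cd.
move=> _ [a [b [a' [b' [b0 b'0 -> ab]]]]].
have [->|a0] := eqVneq a 0.
  by rewrite tofrac0 mul0r invr0 -tofrac0 -polyC0; exact: conjugable_cst.
have a'0 : a' != 0.
  apply: contraNneq a0 => a'0; apply/eqP.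
  apply: (zariski_eq0 dX (mulf_neq0 b0 b'0)) => x Xx.
  rewrite hornerM mulf_eq0 negb_or => /andP[bx b'x]; apply/eqP.
  have := ab x Xx bx b'x; rewrite a'0 horner0 mul0r => /eqP.
  by rewrite conjC_eq0 mulf_eq0 invr_eq0 (negPf bx) orbF.
have bb0 : b * b' != 0 by exact: mulf_neq0.
(* The factor [b * b'] cancels in the fraction, but confines the pointwise condition to points where
   [ab] applies. *)
exists (b * (b * b')), (a * (b * b')), b', a'; split=> //; first exact: mulf_neq0.
  have bb0F : (b * b')%:F != 0 by rewrite tofrac_eq0.
  by rewrite invf_div !(tofracM _ (b * b')) -mulf_div (divff bb0F) mulr1.
move=> x Xx; rewrite !hornerM !mulf_eq0 !negb_or => /and3P[ax bx b'x] a'x.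
rewrite -mulf_div divff ?mulf_neq0 // mulr1.
have := congr1 (fun z => z^-1) (ab x Xx bx b'x).
by rewrite -(fmorphV Num.conj) !invf_div.
Qed.

Lemma real_generator X f : zariski_dense X -> conjugable X f ->
  (forall c, f <> cstf c) ->
  exists p q e, [/\ q != 0, coprimep p q, nonproportional p q & e != 0] /\
    (forall x, X x -> e.[x] != 0 -> p.[x] / q.[x] \is Num.real) /\
    (forall g, conjugable X g -> genf (p%:F / q%:F) g).
Proof.
move=> dX Xf fc.
have [v [Xv vc gv]] := luroth (subfield_conjugable dX) (conjugable_cst X) Xf fc.
have [p1 [q1 [q10 vE1]]] := fracP v.
have [p [q [q0 cpq vE2 _ _]]] := frac_coprime p1 q10.
have vE : v = p%:F / q%:F by rewrite vE1.
have npq : nonproportional p q by move=> c /(frac_eq_cst _ _ q0); rewrite -vE; exact: vc.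
have [a [b [a' [b' [b0 b'0 vab ab]]]]] := Xv.
(* The conjugate [a' / b'] of [v] is conjugable, with conjugate [v]; hence it is a rational function
   [A / B] of [v]. *)
have Xv' : conjugable X (a'%:F / b'%:F).
  by exists a', b', a, b; split=> // x Xx b'x bx; rewrite -ab // conjCK.
have [A [B [vB abE]]] := gv _ Xv'.
pose n := maxn (size A) (size B).
have sA : (size A <= n.+1)%N by rewrite leqW // leq_maxl.
have sB : (size B <= n.+1)%N by rewrite leqW // leq_maxr.
rewrite vE in vB abE.
have [hB0 hE] := homog_comp_frac sA sB b'0 q0 vB abE.
set hB := homog_comp n B p q in hB0 hE.
have apE : a * q = p * b.
  apply/eqP; rewrite -tofrac_eq [X in X == _]tofracM [X in _ == X]tofracM.
  have b0F : b%:F != 0 by rewrite tofrac_eq0.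
  have q0F : q%:F != 0 by rewrite tofrac_eq0.
  by rewrite -(eqr_div _ _ b0F q0F) -vab vE.
have B0 : B != 0.
  by apply: contraNneq vB => ->; rewrite evfC /cstf tofrac0.
(* Off the roots of [e1] and [q], the values of [a / b], [a' / b'] and $(A/B)(p/q)$ are all
   defined. *)
pose e1 := b * b' * hB.
have e10 : e1 != 0 by rewrite !mulf_neq0.
have TAB t : frac_image X e1 p q t -> t^* * B.[t] = A.[t].
  move=> [x [Xx]]; rewrite !hornerM !mulf_eq0 !negb_or => /andP[/andP[bx b'x] hx] qx ->.
  have [Bt abt] := horner_frac sA sB hE b'x qx hx.
  have -> : p.[x] / q.[x] = a.[x] / b.[x].
    by apply/esym/eqP; rewrite eqr_div // -!hornerM apE.
  have tE : a.[x] / b.[x] = p.[x] / q.[x].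
    by apply/eqP; rewrite eqr_div // -!hornerM apE.
  by rewrite ab // tE abt mulfVK.
have dT := zariski_dense_image dX e10 q0 npq.
have [t0 [l [m [e [l0 e0 Treal]]]]] := schwarz_circle dT B0 TAB.
have d0 : p - t0 *: q != 0 by rewrite subr_eq0; apply/eqP/npq.
have [w1 [w2 [w20 cw wE _ _]]] := frac_coprime (l *: q + m *: (p - t0 *: q)) d0.
have d0F : (p - t0 *: q)%:F != 0 by rewrite tofrac_eq0.
have q0F : q%:F != 0 by rewrite tofrac_eq0.
have vt0 : v != cstf t0 by apply/eqP/vc.
have wv : w1%:F / w2%:F = cstf l / (v - cstf t0) + cstf m.
  have cstZ c (r : {poly C}) : (c *: r)%:F = cstf c * r%:F by rewrite -mul_polyC tofracM.
  rewrite -wE tofracD mulrDl !cstZ (mulfK d0F); congr (_ + _).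
  have -> : v - cstf t0 = (p - t0 *: q)%:F / q%:F.
    by rewrite vE tofracB mulrBl cstZ (mulfK q0F).
  by rewrite invf_div mulrA.
have gw : genf (w1%:F / w2%:F) v by rewrite wv; exact: genf_mobius.
have nw : nonproportional w1 w2.
  move=> c /(frac_eq_cst _ _ w20) wc; rewrite wc in gw.
  by have [c' /vc] := genf_cst_l gw.
(* The pullback of [e] along [v]: off its roots and those of [q], the value of [v] is not a root of
   [e]. *)
pose he := homog_comp (size e) e p q.
have he0 : he != 0.
  have q0Fn : q%:F ^+ size e != 0 by rewrite expf_eq0 tofrac_eq0 (negPf q0) andbF.
  rewrite -tofrac_eq0 (evf_homog_comp p (leqnSn _) q0); apply: (mulf_neq0 q0Fn); rewrite -vE.
  by apply/negP => /eqP /(evf_eq0 vc) /eqP; apply/negP.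
exists w1, w2, (e1 * he * q * (p - t0 *: q) * w2); split; first split=> //.
  by rewrite !mulf_neq0.
split=> [x Xx|g Xg]; last by apply: genf_trans gw _; exact: gv.
rewrite 4!hornerM 4!mulf_eq0 4!negb_or.
move=> /andP[/andP[/andP[/andP[e1x hex] qx] dx] w2x].
have [] := Treal (p.[x] / q.[x]); first by exists x.
  by move: hex; rewrite horner_homog_comp // mulf_eq0 negb_or => /andP[].
move=> tt0; congr (_ \is Num.real).
have wp : w1 * (p - t0 *: q) = (l *: q + m *: (p - t0 *: q)) * w2.
  apply/eqP; rewrite -tofrac_eq [X in X == _]tofracM [X in _ == X]tofracM.
  have w20F : w2%:F != 0 by rewrite tofrac_eq0.
  by rewrite -(eqr_div _ _ w20F d0F) wE.
have -> : w1.[x] / w2.[x] = (l *: q + m *: (p - t0 *: q)).[x] / (p - t0 *: q).[x].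
  by apply/eqP; rewrite eqr_div // -!hornerM wp.
have dE : p.[x] / q.[x] - t0 = (p - t0 *: q).[x] / q.[x].
  by rewrite hornerD hornerN hornerZ mulrBl mulfK.
rewrite dE; move: (p - t0 *: q) dx => d dx.
by rewrite hornerD !hornerZ mulrDl mulfK // invf_div mulrA.
Qed.

(** A reduced fraction with monic denominator is unique, and [A / B] agrees with its conjugate on a
    dense set of real values [t]. *)
Lemma real_quotient X p q e a b : zariski_dense X ->
  q != 0 -> nonproportional p q -> e != 0 -> b != 0 ->
  (forall x, X x -> e.[x] != 0 -> p.[x] / q.[x] \is Num.real) ->
  (forall x, X x -> b.[x] != 0 -> a.[x] / b.[x] \is Num.real) ->
  genf (p%:F / q%:F) (a%:F / b%:F) ->
  exists A B, [/\ coprimep A B, A \is a polyOver Num.real, B \is a polyOver Num.real,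
    evf (p%:F / q%:F) B != 0 &
    a%:F / b%:F = evf (p%:F / q%:F) A / evf (p%:F / q%:F) B].
Proof.
move=> dX q0 npq e0 b0 wreal abreal [A0 [B0 [vB0 abE0]]].
have B00 : B0 != 0 by apply: contraNneq vB0 => ->; rewrite evfC /cstf tofrac0.
pose g := gcdp A0 B0.
have EA : A0 = A0 %/ g * g by rewrite divpK // dvdp_gcdl.
have EB : B0 = B0 %/ g * g by rewrite divpK // dvdp_gcdr.
pose l := lead_coef (B0 %/ g).
have B1 : B0 %/ g != 0 by apply: contraNneq B00 => B1; rewrite EB B1 mul0r.
have l0 : l != 0 by rewrite lead_coef_eq0.
pose A := l^-1 *: (A0 %/ g); pose B := l^-1 *: (B0 %/ g).
have EA' : A0 = A * (l *: g) by rewrite -scalerAl -scalerAr scalerA mulVf // scale1r.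
have EB' : B0 = B * (l *: g) by rewrite -scalerAl -scalerAr scalerA mulVf // scale1r.
have cAB : coprimep A B.
  by rewrite coprimepZl ?coprimepZr ?invr_eq0 // coprimep_div_gcd // B00 orbT.
have mB : B \is monic by rewrite monicE lead_coefZ mulVf.
move: vB0 abE0; rewrite EA' EB' !evfM => vBg abE0.
have vB : evf (p%:F / q%:F) B != 0.
  by apply: contraNneq vBg => ->; rewrite mul0r.
have vg : evf (p%:F / q%:F) (l *: g) != 0.
  by apply: contraNneq vBg => ->; rewrite mulr0.
have abE : a%:F / b%:F = evf (p%:F / q%:F) A / evf (p%:F / q%:F) B.
  by rewrite abE0 -mulf_div (divff vg) mulr1.
pose n := maxn (size A) (size B).
have sA : (size A <= n.+1)%N by rewrite leqW // leq_maxl.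
have sB : (size B <= n.+1)%N by rewrite leqW // leq_maxr.
have [hB0 hE] := homog_comp_frac sA sB b0 q0 vB abE.
have e10 : e * b * homog_comp n B p q != 0 by rewrite !mulf_neq0.
have dT := zariski_dense_image dX e10 q0 npq.
have conjAB : A * conjp B = conjp A * B.
  apply/eqP; rewrite -subr_eq0; apply/eqP.
  apply: (zariski_eq0 dT (oner_neq0 _)) => t [x [Xx]].
  rewrite !hornerM !mulf_eq0 !negb_or => /andP[/andP[ex bx] hx] qx tE _.
  have [Bt abt] := horner_frac sA sB hE bx qx hx.
  have tr : t^* = t by apply/CrealP; rewrite tE; exact: wreal.
  have := abreal x Xx bx; rewrite abt -tE => /CrealP.
  rewrite rmorphM fmorphV /= -!horner_conjp tr => /esym/eqP.
  rewrite -tE in Bt; rewrite eqr_div // ?hornerD ?hornerN ?hornerM; last first.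
    by have := horner_conjp B t; rewrite tr => ->; rewrite conjC_eq0.
  by rewrite -subr_eq0 => /eqP.
have realP (P : {poly C}) : conjp P = P -> P \is a polyOver Num.real.
  move=> PP; apply/polyOverP => i; apply/CrealP.
  by rewrite -[in RHS]PP coef_map.
(* [B] divides [conjp B] because it is coprime to [A]; both are monic of the same size. *)
have BB : conjp B = B.
  have dB : B %| conjp B.
    by rewrite -(Gauss_dvdpr _ (_ : coprimep B A)) ?conjAB ?dvdp_mulIr // coprimep_sym.
  have mcB : conjp B \is monic by rewrite monicE lead_coef_map (monicP mB) rmorph1.
  apply/esym/eqP; rewrite -eqp_monic //.
  by rewrite -(dvdp_size_eqp dB) size_conjp.
exists A, B; split=> //; apply: realP => //.
have B_neq0 := monic_neq0 mB.
by apply: (mulIf B_neq0); rewrite -conjAB BB.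
Qed.

End Composition.

(** * Real fibres on the Riemann sphere and the common decomposition *)

Section RealFibres.
Variable R : realType.
Local Notation C := R[i].

(** Otherwise [S] would contain only roots of [e] and possibly the point at infinity. *)
Lemma infinite_zariski_dense (S : set (CP1 R)) : infinite_set S ->
  zariski_dense (fun x : C => S (Some x)).
Proof.
move=> infS e e0; apply: contrapT => /forallNP noX; apply: infS.
have [s es] := closed_field_poly_normal e.
apply: (@sub_finite_set _ _ [set` None :: map Some s]); last exact: finite_seq.
move=> [x|_]; last exact: mem_head.
move=> Sx; rewrite /= in_cons /= mem_map; last by move=> ? ? [].
have /eqP : e.[x] = 0.
  by apply/eqP; apply: contrapT => /negP ex; apply: (noX x).
rewrite es hornerZ mulf_eq0 lead_coef_eq0 (negPf e0) /=.
by rewrite -[_ == 0]/(root _ x) root_prod_XsubC.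
Qed.

Lemma ratf_preimage_real (f : ratf R) (K : set R) (x : C) :
  ratf_preimage f K (Some x) ->
  (ratf_num f).[x] / (ratf_den f).[x] \is Num.real.
Proof.
move=> [r _] /=; case: ifP => // _ [->].
by rewrite complex_real.
Qed.

Lemma ratf_nonproportional (f : ratf R) :
  ~ ratf_const f -> nonproportional (ratf_num f) (ratf_den f).
Proof. by move=> nf c fc; apply: nf; exists c. Qed.

Lemma real_decomposition X (W f : ratf R) e : zariski_dense X ->
  nonproportional (ratf_num W) (ratf_den W) -> e != 0 ->
  (forall x, X x -> e.[x] != 0 ->
    (ratf_num W).[x] / (ratf_den W).[x] \is Num.real) ->
  (forall x, X x -> (ratf_num f).[x] / (ratf_den f).[x] \is Num.real) ->
  genf (FracField.tofrac (ratf_num W) / FracField.tofrac (ratf_den W))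
       (FracField.tofrac (ratf_num f) / FracField.tofrac (ratf_den f)) ->
  exists P : ratf R, ratf_real P /\ ratf_eq_comp f P W.
Proof.
move=> dX nW e0 Wreal freal gf.
have f0 := ratf_den_neq0 f; have W0 := ratf_den_neq0 W.
have freal' x : X x -> (ratf_den f).[x] != 0 -> (ratf_num f).[x] / (ratf_den f).[x] \is Num.real.
  by move=> Xx _; exact: freal.
have [A [B [cAB rA rB vB abE]]] := real_quotient dX W0 nW e0 f0 Wreal freal' gf.
have B0 : B != 0.
  by apply: contraNneq vB => ->; rewrite evfC /cstf tofrac0.
exists (Ratf B0 cAB); split; first by split.
(* [ratf_deg] is the larger size minus one, so both sizes are at most its successor. *)
apply: homog_comp_frac => //; rewrite /ratf_deg /=.
  by apply: leq_trans (leqSpred _); exact: leq_maxl.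
by apply: leq_trans (leqSpred _); exact: leq_maxr.
Qed.

End RealFibres.

Local Open Scope classical_set_scope.

Theorem theorem2 (R : realType) (beta1 beta2 : ratf R) (K1 K2 : set R) :
  ~ ratf_const beta1 -> ~ ratf_const beta2 ->
  infinite_set (ratf_preimage beta1 K1 `&` ratf_preimage beta2 K2) ->
  exists (W P1 P2 : ratf R),
    ratf_real P1 /\ ratf_real P2 /\
    ratf_eq_comp beta1 P1 W /\ ratf_eq_comp beta2 P2 W.
Proof.
move=> nb1 _ /infinite_zariski_dense; set X := fun x => _ => dX.
have real1 x : X x -> (ratf_num beta1).[x] / (ratf_den beta1).[x] \is Num.real.
  by case=> /ratf_preimage_real.
have real2 x : X x -> (ratf_num beta2).[x] / (ratf_den beta2).[x] \is Num.real.
  by case=> _ /ratf_preimage_real.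
have conj_real (f : ratf R) :
    (forall x, X x -> (ratf_num f).[x] / (ratf_den f).[x] \is Num.real) ->
    conjugable X (FracField.tofrac (ratf_num f) / FracField.tofrac (ratf_den f)).
  (* A function that is real on [X] is its own conjugate there. *)
  move=> freal; exists (ratf_num f), (ratf_den f), (ratf_num f), (ratf_den f).
  split; rewrite ?ratf_den_neq0 // => x Xx _ _.
  by apply/CrealP; exact: freal.
have Xb1 := conj_real _ real1; have Xb2 := conj_real _ real2.
have nc1 c : FracField.tofrac (ratf_num beta1) / FracField.tofrac (ratf_den beta1)
    <> cstf c.
  by move/(frac_eq_cst _ _ (ratf_den_neq0 beta1)); exact: ratf_nonproportional.
(* One [W] serves both functions, since every conjugable function is a rational function of it. *)
have [p [q [e [[q0 cpq npq e0] [wreal gw]]]]] := real_generator dX Xb1 nc1.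
pose W := Ratf q0 cpq.
have [P1 [rP1 cP1]] :=
  @real_decomposition R X W beta1 e dX npq e0 wreal real1 (gw _ Xb1).
have [P2 [rP2 cP2]] :=
  @real_decomposition R X W beta2 e dX npq e0 wreal real2 (gw _ Xb2).
by exists W, P1, P2.
Qed.
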